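(* Let $\mathbf K_I,\mathbf K_J$ be Kuranishi charts and let $U_{IJ}\subset U_I$, $\phi_{IJ}:U_{IJ}\to U_J$, $\widehat\phi_{IJ}:E_I\to E_J$ be a domain, smooth embedding and linear injection that satisfy all conditions of a coordinate change from $\mathbf K_I$ to $\mathbf K_J$ except possibly the index condition. Then the index condition is equivalent to the tangent bundle condition, which requires isomorphisms for all $v=\phi_{IJ}(u)\in\phi_{IJ}(U_{IJ})$, $$d_vs_J:\ T_vU_J\big/d_u\phi_{IJ}(T_uU_I)\ \xrightarrow{\ \cong\ }\ E_J\big/\widehat\phi_{IJ}(E_I),\qquad(\ast)$$ or equivalently, for all $u\in U_{IJ}$ and $v=\phi_{IJ}(u)$, $$E_J=\operatorname{im}d_vs_J+\operatorname{im}\widehat\phi_{IJ}\quad\text{and}\quad\operatorname{im}d_vs_J\cap\operatorname{im}\widehat\phi_{IJ}=\widehat\phi_{IJ}(\operatorname{im}d_us_I).$$ Moreover, the tangent bundle condition implies that the charts $\mathbf K_I,\mathbf K_J$ have the same dimension, and that $\phi_{IJ}(U_{IJ})$ is an open subset of $s_J^{-1}(\widehat\phi_{IJ}(E_I))$ with $$\operatorname{im}d_u\phi_{IJ}=(d_vs_J)^{-1}\big(\widehat\phi_{IJ}(E_I)\big)\qquad\forall\,v=\phi_{IJ}(u)\in\phi_{IJ}(U_{IJ}).$$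
   Context: $X$ is a compact metrizable space. A Kuranishi chart (trivial isotropy) for $X$ with footprint a nonempty open $F\subset X$ is $\mathbf K=(U,E,s,\psi)$ with $U$ a finite-dimensional smooth manifold (without boundary), $E$ a finite-dimensional real vector space, $s:U\to E$ smooth, and $\psi:s^{-1}(0)\to X$ a homeomorphism onto $F$; $\dim\mathbf K=\dim U-\dim E$. A coordinate change from $\mathbf K_I$ to $\mathbf K_J$ (where $F_I\cap F_J\neq\emptyset$) consists of an open $U_{IJ}\subset U_I$ with $U_{IJ}\cap s_I^{-1}(0)=\psi_I^{-1}(F_I\cap F_J)$, a smooth embedding $\phi_{IJ}:U_{IJ}\to U_J$ and a linear injection $\widehat\phi_{IJ}:E_I\to E_J$ such that $s_J\circ\phi_{IJ}=\widehat\phi_{IJ}\circ s_I$ on $U_{IJ}$, $\phi_{IJ}=\psi_J^{-1}\circ\psi_I$ on $U_{IJ}\cap s_I^{-1}(0)$, and the index condition holds: for all $u\in U_{IJ}$, (i) $d_u\phi_{IJ}(\ker d_us_I)=\ker d_{\phi_{IJ}(u)}s_J$; and (ii) whenever $E_I=\operatorname{im}d_us_I\oplus C_{u,I}$, then $E_J=\operatorname{im}d_{\phi_{IJ}(u)}s_J\oplus\widehat\phi_{IJ}(C_{u,I})$. The map in $(\ast)$ is induced by $d_vs_J$; it is well defined since $d_vs_J\circ d_u\phi_{IJ}=\widehat\phi_{IJ}\circ d_us_I$.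
   Formalization: The displayed sum and intersection conditions are shown to imply (∗) only when the charts have the same dimension; without this the claimed equivalence is false (s_I = x², s_J = x²+y², φ(x) = (x,0)). That (∗) implies them is shown unconditionally. *)

(* Defs.v *)
From HB Require Import structures.
From mathcomp Require Import all_boot all_order all_algebra.
From mathcomp Require Import all_classical all_reals all_analysis.

Set Implicit Arguments.
Unset Strict Implicit.
Unset Printing Implicit Defensive.

Import Order.TTheory GRing.Theory Num.Theory.
Import numFieldNormedType.Exports.

Local Open Scope classical_set_scope.
Local Open Scope quotient_scope.
Local Open Scope ring_scope.

Section QuotientSpace.
Variables (R : fieldType) (V : vectType R) (W : {vspace V}).

Definition vquot : Type := Quotient.quot (pred_of_vspace W).

HB.instance Definition _ := EqQuotient.on vquot.
HB.instance Definition _ := GRing.Zmodule.on vquot.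
HB.instance Definition _ := ZmodQuotient.on vquot.

Definition vquot_pi (v : V) : vquot := \pi_vquot v.

Lemma vquot_piE (u v : V) : (vquot_pi u == vquot_pi v) = (u - v \in W).
Proof. by rewrite /vquot_pi -Quotient.idealrBE. Qed.

Lemma vquot_piD (u v : V) : vquot_pi (u + v) = vquot_pi u + vquot_pi v.
Proof. by rewrite /vquot_pi raddfD. Qed.

Lemma vquot_reprK (x : vquot) : vquot_pi (repr x) = x.
Proof. exact: reprK. Qed.

Definition vquot_scale (a : R) (x : vquot) : vquot := vquot_pi (a *: repr x).

Lemma vquot_piZ (a : R) (v : V) : vquot_pi (a *: v) = vquot_scale a (vquot_pi v).
Proof.
apply/eqP; rewrite vquot_piE -scalerBr memvZ// -vquot_piE.
by rewrite vquot_reprK.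
Qed.

Fact vquot_scaleA a b x :
  vquot_scale a (vquot_scale b x) = vquot_scale (a * b) x.
Proof. by rewrite -[x]vquot_reprK -!vquot_piZ scalerA. Qed.

Fact vquot_scale1 : left_id 1 vquot_scale.
Proof. by move=> x; rewrite -[x]vquot_reprK -vquot_piZ scale1r. Qed.

Fact vquot_scaleDr : right_distributive vquot_scale +%R.
Proof.
move=> a x y; rewrite -[x]vquot_reprK -[y]vquot_reprK -!vquot_piZ.
by rewrite -!vquot_piD -vquot_piZ scalerDr.
Qed.

Fact vquot_scaleDl x : {morph vquot_scale^~ x : a b / a + b}.
Proof.
move=> a b; rewrite -[x]vquot_reprK -!vquot_piZ -vquot_piD.
by rewrite scalerDl.
Qed.

HB.instance Definition _ := GRing.Zmodule_isLmodule.Build R vquot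
  vquot_scaleA vquot_scale1 vquot_scaleDr vquot_scaleDl.

End QuotientSpace.

(* The linear map V -> V' induces a linear isomorphism V / A -> V' / B. *)
Definition induces_quotient_iso (R : fieldType) (V V' : vectType R)
    (f : 'Hom(V, V')) (A : {vspace V}) (B : {vspace V'}) : Prop :=
  exists g : {linear vquot A -> vquot B},
    (forall v, g (vquot_pi A v) = vquot_pi B (f v)) /\ bijective g.

(* Internal direct sum V = A (+) C. *)
Definition direct_sum_decomp (R : fieldType) (V : vectType R)
    (A C : {vspace V}) : Prop :=
  (A + C)%VS = fullv /\ directv (A + C).

(* f restricts to a homeomorphism from the subspace A onto the subspace B,
   with inverse the restriction of g; f and g are irrelevant outside A and B. *)
Definition homeo_on (S T : topologicalType) (A : set S) (B : set T)
    (f : S -> T) (g : T -> S) : Prop :=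
  [/\ f @` A = B, (forall x, A x -> g (f x) = x),
      {within A, continuous f} & {within B, continuous g}].

Definition metrizable (R : realType) (X : topologicalType) : Prop :=
  exists (Y : metricType R) (f : X -> Y) (g : Y -> X),
    homeo_on [set: X] [set: Y] f g.

(* C^k maps on an open subset D of R^m; all directional derivatives of a
   C^(k+1) map are required to be C^k. *)
Fixpoint Ck_on (R : realType) (m n k : nat) (D : set 'rV[R]_m)
    (f : 'rV[R]_m -> 'rV[R]_n) : Prop :=
  if k is k'.+1 then
    (forall x, D x -> differentiable f x) /\
    (forall v, Ck_on k' D (fun x => 'd f x v))
  else forall x, D x -> {for x, continuous f}.

Definition smooth_on (R : realType) (m n : nat) (D : set 'rV[R]_m)
    (f : 'rV[R]_m -> 'rV[R]_n) : Prop :=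
  forall k, Ck_on k D f.

Record local_chart (R : realType) (M : topologicalType) (n : nat) := LocalChart {
  cdom : set M ;
  cmap : M -> 'rV[R]_n ;
  cinv : 'rV[R]_n -> M ;
  cdom_open : open cdom ;
  cmap_open : open (cmap @` cdom) ;
  cmap_homeo : homeo_on cdom (cmap @` cdom) cmap cinv
}.

(* The atlas need not be maximal; it stands for the smooth structure that it
   generates. *)
Record manifold (R : realType) := Manifold {
  mspace :> topologicalType ;
  mdim : nat ;
  mhausdorff : hausdorff_space mspace ;
  mcountable : @second_countable mspace ;
  atlas : set (local_chart R mspace mdim) ;
  atlas_cover : forall x, exists2 c, atlas c & cdom c x ;
  atlas_smooth : forall c c', atlas c -> atlas c' ->
    smooth_on (cmap c @` (cdom c `&` cdom c')) (cmap c' \o cinv c)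
}.

Definition chart_at (R : realType) (M : manifold R) (x : M) :
    local_chart R M (mdim M) :=
  s2val (cid2 (atlas_cover x)).

(* The tangent space at x is R^n, read in the chart chosen at x; the maps tmap
   and tfun below read differentials in the charts chosen at the points. *)
Definition tangent (R : realType) (M : manifold R) (x : M) : vectType R :=
  'rV[R]_(mdim M).

Definition smooth_map_on (R : realType) (M N : manifold R) (D : set M)
    (f : M -> N) : Prop :=
  (forall x, D x -> {for x, continuous f}) /\
  forall c c', atlas c -> atlas c' ->
    smooth_on (cmap c @` (cdom c `&` D `&` f @^-1` cdom c'))
              (cmap c' \o f \o cinv c).

Definition tmap (R : realType) (M N : manifold R) (f : M -> N) (x : M) :
    'Hom(tangent x, tangent (f x)) :=
  linfun ('d (cmap (chart_at (f x)) \o f \o cinv (chart_at x))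
             (cmap (chart_at x) x)).

(* A finite-dimensional vector space carries the smooth structure given by
   linear coordinates. *)
Definition vcoords (R : realType) (E : vectType R) : E -> 'rV[R]_(\dim {:E}) :=
  passmx.rVof (vbasis {:E}).

HB.instance Definition _ (R : realType) (E : vectType R) :=
  GRing.isSemilinear.Build R E _ _ (@vcoords R E)
    (GRing.semilinear_linear (passmx.rVof_linear (vbasis {:E}))).

Definition of_vcoords (R : realType) (E : vectType R) :
    'rV[R]_(\dim {:E}) -> E :=
  passmx.vecof (vbasis {:E}).

HB.instance Definition _ (R : realType) (E : vectType R) :=
  GRing.isSemilinear.Build R _ E _ (@of_vcoords R E)
    (GRing.semilinear_linear (passmx.vecof_linear (vbasis {:E}))).

Definition smooth_fun (R : realType) (M : manifold R) (E : vectType R)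
    (s : M -> E) : Prop :=
  forall c, atlas c ->
    smooth_on (cmap c @` cdom c) (@vcoords R E \o s \o cinv c).

Definition tfun (R : realType) (M : manifold R) (E : vectType R)
    (s : M -> E) (x : M) : 'Hom(tangent x, E) :=
  linfun (@of_vcoords R E \o
          'd (@vcoords R E \o s \o cinv (chart_at x)) (cmap (chart_at x) x)).

(* Smooth embedding of the open submanifold D: a smooth immersion that is a
   homeomorphism onto its image. *)
Definition smooth_embedding_on (R : realType) (M N : manifold R) (D : set M)
    (f : M -> N) : Prop :=
  [/\ smooth_map_on D f,
      (forall x, D x -> injective (tmap f x)) &
      exists g, homeo_on D (f @` D) f g].

(* kpsi and kpsi_inv only matter on the zero set of ks and on kfoot. *)
Record kuranishi_chart (R : realType) (X : topologicalType) := KuranishiChart {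
  kU : manifold R ;
  kE : vectType R ;
  ks : kU -> kE ;
  kfoot : set X ;
  kpsi : kU -> X ;
  kpsi_inv : X -> kU ;
  ks_smooth : smooth_fun ks ;
  kfoot_open : open kfoot ;
  kfoot_neq0 : kfoot !=set0 ;
  kpsi_homeo : homeo_on [set u | ks u = 0] kfoot kpsi kpsi_inv
}.

Arguments ks {R X} k _.
Arguments kpsi {R X} k _.
Arguments kpsi_inv {R X} k _.

Definition kzero (R : realType) (X : topologicalType)
    (K : kuranishi_chart R X) : set (kU K) := [set u | ks K u = 0].

Arguments kzero {R X} K _.

Definition kdim (R : realType) (X : topologicalType)
    (K : kuranishi_chart R X) : int :=
  (mdim (kU K))%:Z - (\dim {: kE K})%:Z.

Section CoordinateChange.
Variables (R : realType) (X : topologicalType) (KI KJ : kuranishi_chart R X).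
Variables (UIJ : set (kU KI)) (phi : kU KI -> kU KJ).
Variable phihat : 'Hom(kE KI, kE KJ).

(* All the requirements on a coordinate change but the index condition.
   Only the values of phi on the open set UIJ matter. *)
Record pre_coordinate_change : Prop := PreCoordinateChange {
  pcc_overlap : kfoot KI `&` kfoot KJ !=set0 ;
  pcc_open : open UIJ ;
  pcc_footprint :
    UIJ `&` kzero KI = kzero KI `&` kpsi KI @^-1` (kfoot KI `&` kfoot KJ) ;
  pcc_embedding : smooth_embedding_on UIJ phi ;
  pcc_injective : injective phihat ;
  pcc_section : forall u, UIJ u -> ks KJ (phi u) = phihat (ks KI u) ;
  pcc_psi : forall u, UIJ u -> kzero KI u -> phi u = kpsi_inv KJ (kpsi KI u)
}.

Definition index_condition : Prop :=
  forall u, UIJ u ->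
    (tmap phi u @: lker (tfun (ks KI) u))%VS
      = lker (tfun (ks KJ) (phi u)) /\
    forall C : {vspace kE KI},
      direct_sum_decomp (limg (tfun (ks KI) u)) C ->
      direct_sum_decomp (limg (tfun (ks KJ) (phi u))) (phihat @: C)%VS.

Definition tangent_bundle_condition : Prop :=
  forall u, UIJ u ->
    induces_quotient_iso (tfun (ks KJ) (phi u))
      (limg (tmap phi u)) (limg phihat).

(* Without kdim KI = kdim KJ this does not imply tangent_bundle_condition, as it
   does not force ker d s_J into im d phi: take s_I x = x^2 on R,
   s_J (x, y) = x^2 + y^2 on R^2, phi x = (x, 0), E_I = E_J = R. *)
Definition transversality_condition : Prop :=
  forall u, UIJ u ->
    fullv = (limg (tfun (ks KJ) (phi u)) + limg phihat)%VS /\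
    (limg (tfun (ks KJ) (phi u)) :&: limg phihat)%VS
      = (phihat @: limg (tfun (ks KI) u))%VS.

End CoordinateChange.

(* A is an open subset of the subspace B. *)
Definition open_subset_of (T : topologicalType) (A B : set T) : Prop :=
  exists2 O, open O & A = O `&` B.

(* Main.v *)
(* Pointwise, both conditions say that ker d s_J = d phi (ker d s_I) and that
   d s_J is onto modulo im phihat: a complement of im d s_I is carried by phihat
   to a complement of im d s_J exactly when E_J = im d s_J + im phihat and
   (d s_J)^-1 (im phihat) = im d phi. Equality of dimensions is then a count.
   For openness, work in charts near v = phi u, and let P be a left inverse of
   d phi. The map (P, s_J mod im phihat) has injective derivative at v, so it is
   injective near v; and P o phi has derivative id at u, so it covers a
   neighbourhood of P v. A point w near v with s_J w in im phihat therefore agrees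
   under (P, s_J mod im phihat) with some phi x, and so equals phi x. *)
Require Import Defs.
From HB Require Import structures.
From mathcomp Require Import all_boot all_order all_algebra.
From mathcomp Require Import all_classical all_reals all_analysis.
From mathcomp Require Import zify ring lra.

Set Implicit Arguments.
Unset Strict Implicit.
Unset Printing Implicit Defensive.

Import Order.TTheory GRing.Theory Num.Theory.
Import numFieldNormedType.Exports.

Local Open Scope classical_set_scope.
Local Open Scope ring_scope.

(** * Strict differentiability and a local lifting lemma *)

Section StrictDifferentiability.
Variable R : realType.

(* joins completeness with the norm, as banach_fixed_point requires *)
HB.instance Definition _ m n := Complete.on 'M[R]_(m, n).

Lemma normr_entry_le m (v : 'rV[R]_m) j : `|v ord0 j| <= `|v|.
Proof.
rewrite [leRHS]/Num.norm /= mx_normrE.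
exact: (le_bigmax _ (fun ij : 'I_1 * 'I_m => `|v ij.1 ij.2|) (ord0, j)).
Qed.

Lemma normr_row_le m (v : 'rV[R]_m) (e : R) :
  0 <= e -> (forall j, `|v ord0 j| <= e) -> `|v| <= e.
Proof.
move=> e0 ve; rewrite [leLHS]/Num.norm /= mx_normrE; apply/bigmax_leP; split => //.
by move=> [i j] _ /=; rewrite ord1.
Qed.

Lemma mulmx_bounded m n (K : 'M[R]_(m, n)) :
  exists2 C : R, 0 < C & forall v : 'rV_m, `|v *m K| <= C * `|v|.
Proof.
(* The summand [1] keeps the constant positive even for [K = 0], so that later estimates can divide
   by it. *)
exists (1 + \sum_i \sum_j `|K i j|) => [|v].
  by rewrite ltr_pwDl// sumr_ge0// => i _; rewrite sumr_ge0.
have S0 : 0 <= \sum_i \sum_j `|K i j|.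
  by rewrite sumr_ge0// => i _; rewrite sumr_ge0.
apply: normr_row_le => [|j]; first by rewrite mulr_ge0// addr_ge0.
rewrite mulrDl mul1r mxE (le_trans (ler_norm_sum _ _ _))// -[leLHS]add0r lerD//.
rewrite mulr_suml ler_sum// => i _; rewrite normrM mulrC ler_pM ?normr_entry_le//.
by rewrite (bigD1 j)//= lerDl sumr_ge0.
Qed.

(** Both [x] and [y] move, unlike in differentiability at [a]: this two-point bound is what the
    contraction and injectivity estimates below consume. The derivative is a matrix acting on rows
    from the right. *)
Definition strict_diff m n (f : 'rV[R]_m -> 'rV[R]_n) a (A : 'M[R]_(m, n)) :=
  forall e : R, 0 < e -> exists2 d : R, 0 < d & forall x y,
    `|x - a| < d -> `|y - a| < d ->
    `|f x - f y - (x - y) *m A| <= e * `|x - y|.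

Lemma diff_coord m (u : 'rV[R]_m) j :
  'd (fun v : 'rV[R]_m => v ord0 j : R^o) u =
    (fun v => v ord0 j) :> ('rV[R]_m -> R^o).
Proof.
have @c : {linear 'rV[R]_m -> R^o}.
  by exists (fun v : 'rV[R]_m => v ord0 j : R^o); do 2![eexists];
     do ?[constructor]; rewrite ?mxE// => ? *; rewrite ?mxE//; move=> ?; rewrite !mxE.
rewrite (_ : (fun _ => _) = c)//; apply: diff_lin; exact: coord_continuous.
Qed.

(** The scalar mean value theorem along the segment from [y] to [x]. The intermediate point depends
    on [j], so the equality holds one coordinate at a time. *)
Lemma mean_value_coord m n (f : 'rV[R]_m -> 'rV[R]_n) (x y : 'rV[R]_m) j :
  (forall t : R, 0 <= t <= 1 -> differentiable f (y + t *: (x - y))) ->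
  exists2 t : R, 0 <= t <= 1 &
    (f x - f y) ord0 j = ('d f (y + t *: (x - y)) (x - y)) ord0 j.
Proof.
move=> df.
pose l (t : R^o) : 'rV[R]_m := y + t *: (x - y).
pose h (t : R) : R := f (l t) ord0 j.
pose dh (t : R) : R := ('d f (l t) (x - y)) ord0 j.
have hd t : 0 <= t <= 1 -> is_derive (t : R) 1 h (dh t).
  move=> /df dft.
  have dl : is_diff (t : R^o) l (fun s : R^o => s *: (x - y)).
    (* The derivative of the affine path [l] is written as that of a constant plus that of a linear
       map, the shape that [is_diffD] produces. *)
    have -> : (fun s : R^o => s *: (x - y)) =
        (cst 0 : R^o -> 'rV[R]_m) + (fun s : R^o => s *: (x - y)).
      by apply/funext => s; rewrite fctE /= add0r.
    exact: is_diffD.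
  have ddf : differentiable (f \o l) (t : R^o) by apply: differentiable_comp.
  have dho : differentiable (h : R^o -> R^o) (t : R^o).
    exact: (differentiable_comp ddf (differentiable_coord _ _ _)).
  apply: DeriveDef; first exact/derivable1_diffP.
  have -> : h = (fun u : 'rV[R]_n => u ord0 j : R^o) \o (f \o l) by [].
  rewrite deriveE//.
  rewrite diff_comp//; last exact: differentiable_coord.
  rewrite /= diff_comp//= diff_val scale1r.
  by rewrite diff_coord.
have [t t01 ht] : exists2 t, t \in `]0, 1[ & h 1 - h 0 = dh t * (1 - 0).
  apply: MVT => //.
    by move=> t; rewrite in_itv/= => /andP[/ltW t0 /ltW t1]; apply: hd; rewrite t0.
  apply: derivable_within_continuous => t; rewrite in_itv/= => t01.
  by have [] := hd t t01.
exists t.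
  by move: t01; rewrite in_itv/= => /andP[/ltW -> /ltW ->].
move: ht; rewrite /h /l /dh scale1r scale0r addr0 subr0 mulr1 [y + _]addrC subrK => <-.
by rewrite !mxE.
Qed.

Lemma linear_dist_le m n (L1 L2 : {linear 'rV[R]_m -> 'rV[R]_n}) (e : R) v :
  0 <= e -> (forall i, `|L1 (delta_mx 0 i) - L2 (delta_mx 0 i)| <= e) ->
  `|L1 v - L2 v| <= m%:R * e * `|v|.
Proof.
move=> e0 L12; apply: normr_row_le => [|j]; first by rewrite !mulr_ge0.
have LE (L : {linear 'rV[R]_m -> 'rV[R]_n}) :
    L v ord0 j = \sum_i v ord0 i * L (delta_mx 0 i) ord0 j.
  rewrite [in LHS](row_sum_delta v) linear_sum summxE.
  by apply: eq_bigr => i _; rewrite linearZ mxE.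
rewrite !mxE !LE -sumrB (le_trans (ler_norm_sum _ _ _))//.
have -> : m%:R * e * `|v| = \sum_(i < m) `|v| * e.
  by rewrite sumr_const card_ord -[RHS]mulr_natl mulrCA mulrC mulrA.
apply: ler_sum => i _; rewrite -mulrBr normrM ler_pM ?normr_entry_le//.
rewrite (le_trans _ (L12 i))// (le_trans _ (normr_entry_le _ j))//.
by rewrite !mxE.
Qed.

(** On a small ball all derivatives are close to the one at [a], and the mean value theorem carries
    this over to increments. The norm is the maximum of the coordinates, so each coordinate may use
    its own intermediate point. *)
Lemma C1_strict_diff m n (f : 'rV[R]_m -> 'rV[R]_n) (a : 'rV[R]_m) :
  (\forall x \near a, differentiable f x) ->
  (forall v, {for a, continuous (fun x => 'd f x v)}) ->
  strict_diff f a (lin1_mx ('d f a)).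
Proof.
move=> dfn dfc e e0.
(* Passing from basis vectors to all vectors costs a factor [m]; dividing by [m.+1] absorbs it and
   is safe for [m = 0]. *)
pose e' := e / m.+1%:R.
have e'0 : 0 < e' by rewrite divr_gt0.
have : \forall x \near a, differentiable f x /\
    forall i : 'I_m, `|'d f x (delta_mx 0 i) - 'd f a (delta_mx 0 i)| < e'.
  apply: filterI => //.
  pose P (i : 'I_m) x := `|'d f x (delta_mx 0 i) - 'd f a (delta_mx 0 i)| < e'.
  apply: (@filter_forall _ _ P (nbhs a) (nbhs_filter a)) => i; rewrite /P.
  by have /cvgrPdistC_lt/(_ _ e'0) := dfc (delta_mx 0 i).
move=> /nbhs_normP[d /= d0 Hd]; exists d => // x y xa ya.
(* Balls are convex, so the segment stays where the derivative is controlled. *)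
have seg (t : R) : 0 <= t <= 1 -> `|a - (y + t *: (x - y))| < d.
  move=> /andP[t0 t1].
  have -> : a - (y + t *: (x - y)) = - ((1 - t) *: (y - a) + t *: (x - a)).
    apply/rowP => i; rewrite !mxE; ring.
  rewrite normrN (le_lt_trans (ler_normD _ _))// !normrZ.
  rewrite !ger0_norm ?subr_ge0//.
  have : (1 - t) * `|y - a| <= (1 - t) * Num.max `|y - a| `|x - a|.
    by rewrite ler_wpM2l ?subr_ge0// le_max lexx.
  have : t * `|x - a| <= t * Num.max `|y - a| `|x - a|.
    by rewrite ler_wpM2l// le_max lexx orbT.
  have : Num.max `|y - a| `|x - a| < d by rewrite gt_max ya.
  lra.
apply: normr_row_le => [|j]; first by rewrite mulr_ge0// ltW.
have [t t01 mvt] := @mean_value_coord _ _ f x y j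
  (fun t t01 => (Hd _ (seg t t01)).1).
have {Hd} [_ Hc] := Hd _ (seg t t01).
move: mvt Hc; set c := y + _; move: ('d f c) ('d f a) => L1 L2 mvt L12.
have -> : (f x - f y - (x - y) *m lin1_mx L2) ord0 j =
    (L1 (x - y) - L2 (x - y)) ord0 j.
  by rewrite mul_rV_lin1 mxE mvt [in RHS]mxE.
rewrite (le_trans (normr_entry_le _ j))//.
have {}L12 i : `|L1 (delta_mx 0 i) - L2 (delta_mx 0 i)| <= e' by exact/ltW.
rewrite (le_trans (linear_dist_le _ (ltW e'0) L12))// ler_wpM2r// /e'.
by rewrite mulrCA ger_pMr// ler_pdivrMr// mul1r ler_nat.
Qed.

Lemma strict_diff_lipschitz m n (f : 'rV[R]_m -> 'rV[R]_n) a A :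
  strict_diff f a A -> exists2 C : R, 0 < C &
  exists2 d : R, 0 < d & forall x y, `|x - a| < d -> `|y - a| < d ->
    `|f x - f y| <= C * `|x - y|.
Proof.
move=> /(_ 1 ltr01)[d d0 Hd]; have [C C0 HC] := mulmx_bounded A.
exists (1 + C); first by rewrite addr_gt0.
exists d => // x y xa ya; have := Hd _ _ xa ya; have := HC (x - y).
have := ler_normD (f x - f y - (x - y) *m A) ((x - y) *m A).
by rewrite subrK; lra.
Qed.

End StrictDifferentiability.

(** * Fixed points, approximate lifts and exact local lifts *)

Section LocalLift.
Variables (R : realType) (m n : nat).
Implicit Types (f : 'rV[R]_m -> 'rV[R]_n) (a : 'rV[R]_m) (A : 'M[R]_(m, n)).

(** The closed ball is mapped to itself, since [T x] is within [r / 2] of [T a] and [T a] within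
    [r / 2] of [a]; the Banach fixed point theorem applies there. *)
Lemma contraction_fixed_point (T : 'rV[R]_m -> 'rV[R]_m) a (r : R) :
  0 <= r ->
  (forall x y, `|x - a| <= r -> `|y - a| <= r ->
    `|T x - T y| <= 2^-1 * `|x - y|) ->
  `|T a - a| <= 2^-1 * r ->
  exists2 x, `|x - a| <= r & T x = x.
Proof.
move=> r0 Tlip Ta.
pose U := closed_ball_ (fun x : 'rV[R]_m => `|x|) a r.
have UE x : U x <-> `|x - a| <= r.
  by rewrite /U /closed_ball_ /=; split; rewrite distrC.
have TU : {homo T : x / U x >-> U x}.
  move=> x /UE xa; apply/UE.
  rewrite -[_ - a](subrKA (T a)) (le_trans (ler_normD _ _))//.
  have := Tlip x a xa; rewrite subrr normr0 => /(_ r0).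
  by move: Ta xa; lra.
pose Tf : {fun U >-> U} := mkfun_fun TU.
have ctr : is_contraction Tf.
  exists (2^-1)%:nng => /=; split => /=; first lra.
  by move=> [x y] /= [/UE xU /UE yU]; apply: Tlip.
have [||x Ux Tx] := banach_fixed_point ctr.
- exact: closed_closed_ball_.
- by exists a; apply/UE; rewrite subrr normr0.
by exists x; [exact/UE | rewrite [RHS]Tx].
Qed.

(** Newton iteration with frozen slope: a fixed point of [x - (f x - w) *m P] solves the equation.
    As [A *m P = 1], the linear part of [f] cancels in differences of this map, which leaves the
    strict differentiability error times [P]. *)
Lemma approx_lift f a A (P : 'M[R]_(n, m)) :
  strict_diff f a A -> A *m P = 1%:M ->
  forall r : R, 0 < r -> \forall w \near f a,
    exists2 x, `|x - a| <= r & (f x - w) *m P = 0.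
Proof.
move=> fA AP r r0.
have [C C0 PC] := mulmx_bounded P.
have e0 : 0 < 2^-1 / C by rewrite divr_gt0// invr_gt0.
have [d d0 fd] := fA _ e0.
(* The fixed point is sought in a closed ball, which must fit inside the open ball of radius [d]. *)
pose r' := Num.min r (d / 2).
have r'0 : 0 < r' by rewrite lt_min r0; lra.
have r'r : r' <= r by rewrite ge_min lexx.
have r'd : r' < d by rewrite gt_min; apply/orP; right; lra.
(* Multiplication by [P] costs at most [C], so the first step of the iteration has length at most
   [r' / 2]. *)
apply/nbhs_normP; exists (2^-1 * r' / C) => /=.
  by rewrite divr_gt0// mulr_gt0.
move=> w /= wfa.
have [||x xr Tx] := @contraction_fixed_point
    (fun x => x - (f x - w) *m P) a r' (ltW r'0).
- move=> x y xa ya.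
  have -> : x - (f x - w) *m P - (y - (f y - w) *m P) =
      - ((f x - f y - (x - y) *m A) *m P).
    rewrite !mulmxBl -!mulmxA AP !mulmx1.
    by apply/rowP => i; rewrite !mxE; ring.
  rewrite normrN (le_trans (PC _))// -ler_pdivlMl// mulrC mulrAC.
  by apply: fd; [exact: le_lt_trans xa _|exact: le_lt_trans ya _].
- rewrite addrAC subrr add0r normrN (le_trans (PC _))//.
  by rewrite -ler_pdivlMl// mulrC ltW.
exists x; first exact: le_trans r'r.
by move/eqP: Tx; rewrite -subr_eq0 addrAC subrr add0r oppr_eq0 => /eqP.
Qed.

(** The row space of [W] is the target subspace and [cokermx W] the quotient by it. [approx_lift]
    provides [x] such that [f x] and [w] agree under [P]; both have [g]-values in [W], and the
    injectivity of [row_mx P Q] then forces [f x = w]. *)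
Lemma local_lift p q f (g : 'rV[R]_n -> 'rV[R]_p) a A (B : 'M[R]_(n, p))
    (W : 'M[R]_(q, p)) :
  strict_diff f a A -> strict_diff g (f a) B -> row_free A ->
  (forall z : 'rV_n, (z *m B <= W)%MS -> (z <= A)%MS) ->
  (\forall x \near a, (g (f x) <= W)%MS) ->
  forall N, nbhs a N ->
  \forall w \near f a, (g w <= W)%MS -> exists2 x, N x & f x = w.
Proof.
move=> fA gB freeA BW gfW N Na.
pose P := pinvmx A; have AP : A *m P = 1%:M by rewrite mulmxVp.
pose Q := B *m cokermx W.
have freePQ : row_free (row_mx P Q).
  (* A vector killed by [Q] is sent into [W] by [B], hence equals [y *m A] for some [y]; being
     killed by [P] as well, it has [y = 0]. *)
  apply: inj_row_free => z; rewrite mul_mx_row => /eqP.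
  rewrite row_mx_eq0 => /andP[/eqP zP /eqP zQ].
  have /BW/submxP[y zA] : (z *m B <= W)%MS by rewrite submxE -mulmxA zQ.
  by move: zP; rewrite zA -mulmxA AP mulmx1 => ->; rewrite mul0mx.
pose K := pinvmx (row_mx P Q).
have PQK (z : 'rV_n) : z *m P = 0 -> z = row_mx 0 (z *m Q) *m K.
  by move=> zP; rewrite -zP -mul_mx_row -mulmxA mulmxVp ?mulmx1.
have [C C0 KC] := mulmx_bounded K.
have [D D0 WD] := mulmx_bounded (cokermx W).
(* Recovering a vector through [K] costs [C] and the quotient by [W] costs [D]; this choice leaves
   the factor [2^-1] in [inj]. *)
have e0 : 0 < 2^-1 / (C * D) by rewrite divr_gt0 ?mulr_gt0// invr_gt0.
have [d d0 gd] := gB _ e0.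
have inj w w' : `|w - f a| < d -> `|w' - f a| < d -> (w - w') *m P = 0 ->
    (g w <= W)%MS -> (g w' <= W)%MS -> w = w'.
  move=> wa w'a wP gw gw'.
  have gWW : (g w - g w') *m cokermx W = 0.
    by apply/eqP; rewrite -submxE addmx_sub// eqmx_opp.
  (* Modulo [W] the values of [g] cancel, and only the strict differentiability error remains. *)
  have wwQ : (w - w') *m Q = - ((g w - g w' - (w - w') *m B) *m cokermx W).
    by rewrite [in RHS]mulmxBl gWW sub0r opprK mulmxA.
  have row_mx0_le (v : 'rV_p) : `|row_mx (0 : 'rV[R]_m) v| <= `|v|.
    apply: normr_row_le => // j; rewrite mxE.
    by case: fintype.splitP => k _; rewrite ?mxE ?normr0// normr_entry_le.
  have : `|w - w'| <= 2^-1 * `|w - w'|.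
    rewrite {1}(PQK _ wP) (le_trans (KC _))// wwQ.
    rewrite -ler_pdivlMl// (le_trans (row_mx0_le _))// normrN (le_trans (WD _))//.
    rewrite -ler_pdivlMl// mulrA -invfM mulrA.
    by rewrite [_^-1 * 2^-1]mulrC [D * C]mulrC; exact: gd.
  have := normr_ge0 (w - w') => w0 ww; apply/eqP; rewrite -subr_eq0 -normr_eq0.
  by rewrite eq_le; apply/andP; split; lra.
have [C' C'0 [d' d'0 fC']] := strict_diff_lipschitz fA.
have /nbhs_normP[r /= r0 Hr] : nbhs a (N `&` [set x | (g (f x) <= W)%MS]).
  exact: filterI.
(* The three bounds put [x] in [N] with [g (f x)] in [W], into the region of the Lipschitz bound,
   and [f x] within [d] of [f a]. The halves turn the weak bound of [approx_lift] into strict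
   ones. *)
pose r' := Num.min (r / 2) (Num.min (d' / 2) (d / 2 / C')).
have r'0 : 0 < r' by rewrite !lt_min !divr_gt0.
have fa : \forall w \near f a, `|w - f a| < d.
  by apply/nbhs_normP; exists d => //= w; rewrite /= distrC.
apply: filterS2 fa (approx_lift fA AP r'0) => w wa [x xa xw] gw.
have [xr xd' xd] : [/\ `|x - a| < r, `|x - a| < d' & C' * `|x - a| < d].
  move: xa; rewrite !le_min => /and3P[xr xd' xd]; split; [lra|lra|].
  rewrite -ltr_pdivlMl// mulrC; apply: le_lt_trans xd _.
  by rewrite ltr_pM2r ?invr_gt0//; lra.
have [Nx gx] : N x /\ (g (f x) <= W)%MS by apply: Hr => /=; rewrite distrC.
exists x => //; apply: inj => //.
by rewrite (le_lt_trans (fC' _ _ _ _))// subrr normr0.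
Qed.

End LocalLift.

(** * Quotient isomorphisms and complements *)

Section LinearAlgebra.
Variable F : fieldType.

(** The inclusion of [A] in the preimage of [B] makes the induced map well defined, the reverse
    inclusion makes it injective, and the sum condition makes it surjective. *)
Lemma induces_quotient_isoP (V V' : vectType F) (f : 'Hom(V, V'))
    (A : {vspace V}) (B : {vspace V'}) :
  induces_quotient_iso f A B <->
  (f @^-1: B)%VS = A /\ (limg f + B)%VS = fullv.
Proof.
have pi0 (U : vectType F) (W : {vspace U}) v : (vquot_pi W v == 0) = (v \in W).
  by rewrite -[0](raddf0 \pi_(vquot W)%qT) vquot_piE subr0.
split=> [[g [gE [g' gK g'K]]]|[preB sumB]].
- have g_eq0 x : (g x == 0) = (x == 0) by rewrite -(inj_eq (can_inj gK)) linear0.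
  split; first by apply/vspaceP => v; rewrite -memv_preim -!pi0 -gE g_eq0.
  apply/eqP; rewrite eqEsubv subvf; apply/subvP => e _.
  have : vquot_pi B e == vquot_pi B (f (repr (g' (vquot_pi B e)))).
    by rewrite -gE vquot_reprK g'K.
  rewrite vquot_piE => eB; rewrite -(subrK (f (repr (g' (vquot_pi B e)))) e) addrC.
  by rewrite memv_add// memv_img ?memvf.
pose g (x : vquot A) : vquot B := vquot_pi B (f (repr x)).
have gE v : g (vquot_pi A v) = vquot_pi B (f v).
  apply/eqP; rewrite vquot_piE -linearB memv_preim preB -vquot_piE.
  by rewrite vquot_reprK.
have g_linear : linear g.
  move=> a x y; rewrite -[x]vquot_reprK -[y]vquot_reprK.
  by rewrite -[a *: vquot_pi A _]vquot_piZ -vquot_piD !gE linearP vquot_piD vquot_piZ.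
pose gM := GRing.isLinear.Build _ _ _ _ g g_linear.
pose gL : {linear vquot A -> vquot B} := HB.pack g gM.
exists gL; split=> //.
rewrite -setTT_bijective; split => //.
- move=> x y _ _ /=; rewrite -[x]vquot_reprK -[y]vquot_reprK !gE => /eqP.
  by rewrite vquot_piE -linearB memv_preim preB -vquot_piE => /eqP.
- move=> y _ /=; have /memv_addP[_ /memv_imgP[v _ ->] [b bB yE]] :
    repr y \in (limg f + B)%VS by rewrite sumB memvf.
  exists (vquot_pi A v) => //=; apply/eqP; rewrite gE -[y]vquot_reprK vquot_piE.
  by rewrite yE opprD addrA subrr sub0r memvN.
Qed.

Lemma direct_sum_decompP (V : vectType F) (A C : {vspace V}) :
  direct_sum_decomp A C <-> (A + C)%VS = fullv /\ (A :&: C)%VS = 0%VS.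
Proof. by split=> -[? /directv_addP ?]; split=> //; apply/directv_addP. Qed.

Lemma exists_complement (V : vectType F) (A : {vspace V}) :
  exists C, direct_sum_decomp A C.
Proof.
exists (A^C)%VS; apply/direct_sum_decompP; split; last exact: capv_compl.
exact: addv_complf.
Qed.

Lemma dim_limg_inj (V W : vectType F) (g : 'Hom(V, W)) :
  injective g -> \dim (limg g) = \dim {:V}.
Proof. by move/lker0P/eqP => g0; rewrite limg_dim_eq// g0 capv0. Qed.

(** Rank-nullity for [g] and for its restriction to the preimage, which have the same kernel,
    combined with the dimension formula for [limg g + U]. *)
Lemma dim_preim (V W : vectType F) (g : 'Hom(V, W)) (U : {vspace W}) :
  (limg g + U)%VS = fullv ->
  (\dim (g @^-1: U) + \dim {:W} = \dim {:V} + \dim U)%N.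
Proof.
move=> gU; have := limg_ker_dim g (g @^-1: U).
have -> : (g @^-1: U :&: lker g)%VS = lker g.
  by apply/capv_idPr/subvP => v; rewrite memv_ker -memv_preim => /eqP ->; rewrite mem0v.
have -> : (g @: (g @^-1: U))%VS = (limg g :&: U)%VS.
  by rewrite -lpreim_cap_limg lpreimK ?capvSr // capvC.
have := limg_ker_dim g fullv; rewrite capfv.
have := dimv_sum_cap (limg g) U; rewrite gU; lia.
Qed.

Variables (TI TJ EI EJ : vectType F).
Variables (A : 'Hom(TI, EI)) (B : 'Hom(TJ, EJ)) (f : 'Hom(TI, TJ)) (h : 'Hom(EI, EJ)).
Hypotheses (BfhA : forall x, B (f x) = h (A x)) (h_inj : injective h).

(** At a point [u], the maps [A], [B], [f], [h] stand for the differentials of the two sections, the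
    differential of [phi], and [phihat]. For the forward direction a single complement [C] is
    enough. *)
Lemma index_iff_quotient_iso :
  (f @: lker A)%VS = lker B /\
  (forall C, direct_sum_decomp (limg A) C ->
     direct_sum_decomp (limg B) (h @: C)) <->
  induces_quotient_iso B (limg f) (limg h).
Proof.
rewrite induces_quotient_isoP; split=> [[kerB dsum]|[preB sumB]].
- have [C AC] := exists_complement (limg A).
  have [/direct_sum_decompP[sumA _] /direct_sum_decompP[sumB capB]] := (AC, dsum C AC).
  split; last first.
    by apply/eqP; rewrite eqEsubv subvf -sumB addvS// limgS// subvf.
  apply/vspaceP => w; rewrite -memv_preim; apply/idP/idP; last first.
    by case/memv_imgP => x _ ->; rewrite BfhA memv_img ?memvf.
  case/memv_imgP => e _ Bw.
  have /memv_addP[_ /memv_imgP[x _ ->] [c cC eE]] : e \in (limg A + C)%VS.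
    by rewrite sumA memvf.
  (* Here [h c = B (w - f x)], so [h c] lies in both summands and vanishes; then [w - f x] is in
     [lker B], which is the image of [lker A]. *)
  have : h c \in (limg B :&: h @: C)%VS.
    rewrite memv_cap (memv_img h cC) andbT.
    apply/memv_imgP; exists (w - f x); rewrite ?memvf//.
    by rewrite linearB /= Bw BfhA eE linearD /= addrAC subrr add0r.
  rewrite capB memv0 => /eqP hc0.
  have : w - f x \in lker B.
    by rewrite memv_ker linearB /= Bw BfhA eE linearD /= hc0 addr0 subrr.
  rewrite -kerB => /memv_imgP[y _ wE].
  by rewrite -(subrK (f x) w) wE -linearD memv_img ?memvf.
split.
  apply/vspaceP => w; apply/memv_imgP/idP => [[x + ->]|].
    by rewrite !memv_ker BfhA => /eqP ->; rewrite linear0.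
  rewrite memv_ker => /eqP Bw.
  have /memv_imgP[x _ wE] : w \in limg f by rewrite -preB -memv_preim Bw mem0v.
  exists x => //; rewrite memv_ker -(inj_eq h_inj) linear0 -BfhA -wE Bw//.
move=> C /direct_sum_decompP[sumA capA]; apply/direct_sum_decompP; split.
  (* The image of [h] splits as [h @: limg A + h @: C], and the first part is absorbed by
     [limg B]. *)
  apply/eqP; rewrite eqEsubv subvf -sumB -sumA limgD subv_add addvSl/=.
  rewrite subv_add addvSr andbT (subv_trans _ (addvSl _ _))//.
  apply/subvP => _ /memv_imgP[_ /memv_imgP[x _ ->] ->].
  by rewrite -BfhA memv_img ?memvf.
apply/eqP; rewrite -subv0; apply/subvP => e; rewrite memv_cap memv0.
case/andP => /memv_imgP[w _ eBw] /memv_imgP[c cC ehc].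
have /memv_imgP[x _ wE] : w \in limg f.
  by rewrite -preB -memv_preim -eBw ehc memv_img ?memvf.
have cA : c = A x by apply: h_inj; rewrite -ehc eBw wE BfhA.
have : c \in (limg A :&: C)%VS by rewrite memv_cap cC andbT cA memv_img ?memvf.
by rewrite capA memv0 ehc => /eqP ->; rewrite linear0.
Qed.

Lemma quotient_iso_transversal :
  induces_quotient_iso B (limg f) (limg h) ->
  fullv = (limg B + limg h)%VS /\ (limg B :&: limg h)%VS = (h @: limg A)%VS.
Proof.
rewrite induces_quotient_isoP => -[preB ->]; split=> //.
apply/vspaceP => e; rewrite memv_cap; apply/andP/idP.
  move=> [/memv_imgP[w _ ->]]; rewrite memv_preim preB => /memv_imgP[x _ ->].
  by rewrite BfhA memv_img// memv_img ?memvf.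
case/memv_imgP => _ /memv_imgP[x _ ->] ->; split; last by rewrite memv_img ?memvf.
by rewrite -BfhA memv_img ?memvf.
Qed.

Hypothesis f_inj : injective f.

(** The preimage of [limg h] under [B] is [limg f], so [dim_preim] gives the count once injectivity
    identifies the dimensions of images with those of sources. *)
Lemma quotient_iso_dim :
  induces_quotient_iso B (limg f) (limg h) ->
  (\dim {:TI} + \dim {:EJ} = \dim {:TJ} + \dim {:EI})%N.
Proof.
rewrite induces_quotient_isoP => -[preB /dim_preim].
by rewrite preB !dim_limg_inj.
Qed.

(** Compatibility always puts [limg f] inside the preimage of [limg h]; the dimension count makes
    the inclusion an equality. *)
Lemma transversal_quotient_iso :
  (\dim {:TI} + \dim {:EJ} = \dim {:TJ} + \dim {:EI})%N ->
  fullv = (limg B + limg h)%VS ->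
  induces_quotient_iso B (limg f) (limg h).
Proof.
move=> dimE sumB; apply/induces_quotient_isoP; split=> //.
apply/esym/eqP; rewrite eqEdim; apply/andP; split.
  apply/subvP => _ /memv_imgP[x _ ->].
  by rewrite -memv_preim BfhA memv_img ?memvf.
have := dim_preim (esym sumB); rewrite !dim_limg_inj// -dimE; lia.
Qed.

End LinearAlgebra.

(** * Local expressions in charts *)

Section Differentials.
Variable R : realType.

Lemma mulmxr_continuous m n (K : 'M[R]_(m, n)) :
  continuous (mulmxr K : 'rV[R]_m -> 'rV[R]_n).
Proof.
have [C _ KC] := mulmx_bounded K.
move=> x; apply: bounded_linear_continuous; apply/linear_boundedP.
apply: filterS (nbhs_pinfty_ge (num_real C)) => r Cr v.
by rewrite (le_trans (KC v))// ler_wpM2r.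
Qed.

Lemma near_eq_diff m n (f g : 'rV[R]_m -> 'rV[R]_n) a v :
  (\near a, f a = g a) -> differentiable f a -> differentiable g a ->
  'd f a v = 'd g a v.
Proof.
move=> fg df dg.
exact: etrans (esym (deriveE v df)) (etrans (near_eq_derive v fg) (deriveE v dg)).
Qed.

(** The chain rule on both sides. The two composites agree only near [a], which suffices because
    directional derivatives are local. *)
Lemma diff_comp_mulmx m n p q (f : 'rV[R]_m -> 'rV[R]_n)
    (t : 'rV[R]_n -> 'rV[R]_q) (s : 'rV[R]_m -> 'rV[R]_p) (K : 'M[R]_(p, q)) a v :
  differentiable f a -> differentiable t (f a) -> differentiable s a ->
  (\near a, t (f a) = s a *m K) ->
  'd t (f a) ('d f a v) = 'd s a v *m K.
Proof.
move=> df dt ds tfsK.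
have dK : differentiable (mulmxr K : 'rV[R]_p -> 'rV[R]_q) (s a).
  by apply: linear_differentiable; exact: mulmxr_continuous.
have dtf := congr1 (@^~ v) (diff_comp df dt).
have dsK := congr1 (@^~ v) (diff_comp ds dK).
have dKE := congr1 (@^~ ('d s a v)) (diff_lin (s a) (@mulmxr_continuous _ _ K)).
apply: (etrans (esym dtf)); apply: etrans (etrans dsK dKE).
by apply: near_eq_diff => //; exact: differentiable_comp.
Qed.

Lemma lin1_mx_free m n (L : {linear 'rV[R]_m -> 'rV[R]_n}) :
  injective L -> row_free (lin1_mx L).
Proof.
by move=> Linj; apply: inj_row_free => v; rewrite mul_rV_lin1 => /eqP;
  rewrite -(linear0 L) => /eqP/Linj.
Qed.

Lemma smooth_on_differentiable m n (D : set 'rV[R]_m)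
    (f : 'rV[R]_m -> 'rV[R]_n) a :
  smooth_on D f -> D a -> differentiable f a.
Proof. by move=> /(_ 1%N)[df _]; exact: df. Qed.

Lemma smooth_on_strict_diff m n (D : set 'rV[R]_m)
    (f : 'rV[R]_m -> 'rV[R]_n) a :
  smooth_on D f -> nbhs a D -> strict_diff f a (lin1_mx ('d f a)).
Proof.
move=> /(_ 1%N)[df dfc] Da; apply: C1_strict_diff; first exact: filterS Da.
by move=> v; apply: dfc; exact: nbhs_singleton.
Qed.

Variable E : vectType R.

Lemma vcoordsK : cancel (@vcoords R E) (@of_vcoords R E).
Proof. exact/passmx.rVofK/vbasisP. Qed.

Lemma of_vcoordsK : cancel (@of_vcoords R E) (@vcoords R E).
Proof. exact/passmx.vecofK/vbasisP. Qed.

End Differentials.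

(** * Charts as local homeomorphisms *)

Section Charts.
Variables (R : realType) (M : manifold R).
Implicit Types (c : local_chart R M (mdim M)) (x : M).

Lemma chart_at_atlas x : atlas (chart_at x).
Proof. by rewrite /chart_at; case: cid2. Qed.

Lemma chart_at_dom x : cdom (chart_at x) x.
Proof. by rewrite /chart_at; case: cid2. Qed.

Lemma cmapK c x : cdom c x -> cinv c (cmap c x) = x.
Proof. by case: (cmap_homeo c) => _ + _ _; apply. Qed.

Lemma cmap_continuous c x : cdom c x -> {for x, continuous (cmap c)}.
Proof.
move=> cx; case: (cmap_homeo c) => _ _ + _.
rewrite continuous_open_subspace; last exact: cdom_open.
by apply; rewrite inE.
Qed.

(** Charts are open maps: near [cmap c x] the image of [O] is the preimage of [O] under the
    continuous inverse, cut down to the open image of the chart. *)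
Lemma chart_nbhs c x (O : set M) :
  cdom c x -> nbhs x O -> nbhs (cmap c x) (cmap c @` (cdom c `&` O)).
Proof.
move=> cx xO; case: (cmap_homeo c) => _ _ _.
rewrite continuous_open_subspace; last exact: cmap_open.
have imx : (cmap c @` cdom c) (cmap c x) by exists x.
move=> /(_ (cmap c x)); rewrite inE => /(_ imx); rewrite /continuous_at cmapK//.
move=> /(_ _ xO) /= invO.
have imO : nbhs (cmap c x) (cmap c @` cdom c).
  by apply: open_nbhs_nbhs; split => //; exact: cmap_open.
apply: (@filterS2 _ (nbhs (cmap c x)) _ _ _ _ _ invO imO) => z /= + [y cy yz].
by rewrite -yz cmapK// => Oy; exists y.
Qed.

End Charts.

(** * Maps and sections read in the chosen charts *)

Section LocalExpressions.
Variables (R : realType).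

Definition map_in_charts (M N : manifold R) (f : M -> N) (x : M) :=
  cmap (chart_at (f x)) \o f \o cinv (chart_at x).

Definition fun_in_chart (M : manifold R) (E : vectType R) (s : M -> E) (x : M) :=
  @vcoords R E \o s \o cinv (chart_at x).

Local Notation coord x := (cmap (chart_at x) x).

Lemma tmapE (M N : manifold R) (f : M -> N) x v :
  tmap f x v = 'd (map_in_charts f x) (coord x) v.
Proof. by rewrite lfunE. Qed.

Lemma tfunE (M : manifold R) (E : vectType R) (s : M -> E) x v :
  tfun s x v = of_vcoords ('d (fun_in_chart s x) (coord x) v).
Proof. by rewrite lfunE. Qed.

Lemma map_in_charts_coord (M N : manifold R) (f : M -> N) x :
  map_in_charts f x (coord x) = coord (f x).
Proof. by rewrite /map_in_charts /= cmapK//; exact: chart_at_dom. Qed.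

Section Map.
Variables (M N : manifold R) (D : set M) (f : M -> N) (x : M).
Hypotheses (Dopen : open D) (fsmooth : smooth_map_on D f) (Dx : D x).

Definition map_in_charts_dom :=
  cmap (chart_at x) @`
    (cdom (chart_at x) `&` D `&` f @^-1` cdom (chart_at (f x))).

Lemma map_in_charts_dom_nbhs : nbhs (coord x) map_in_charts_dom.
Proof.
rewrite /map_in_charts_dom -setIA; apply: chart_nbhs; first exact: chart_at_dom.
apply: filterI; first exact: open_nbhs_nbhs.
apply: (fsmooth.1 x Dx); apply: open_nbhs_nbhs; split; first exact: cdom_open.
exact: chart_at_dom.
Qed.

Lemma map_in_charts_smooth : smooth_on map_in_charts_dom (map_in_charts f x).
Proof. by apply: fsmooth.2; exact: chart_at_atlas. Qed.

End Map.

Lemma fun_in_chart_nbhs (M : manifold R) (x : M) :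
  nbhs (coord x) (cmap (chart_at x) @` cdom (chart_at x)).
Proof.
rewrite -[X in cmap _ @` X]setIT; apply: chart_nbhs; first exact: chart_at_dom.
exact: filterT.
Qed.

Lemma fun_in_chart_smooth (M : manifold R) (E : vectType R) (s : M -> E) (x : M) :
  smooth_fun s ->
  smooth_on (cmap (chart_at x) @` cdom (chart_at x)) (fun_in_chart s x).
Proof. by apply; exact: chart_at_atlas. Qed.

Section Compatible.
Variables (M N : manifold R) (E E' : vectType R).
Variables (D : set M) (f : M -> N) (h : 'Hom(E, E')) (s : M -> E) (t : N -> E').
Hypotheses (Dopen : open D) (fsmooth : smooth_map_on D f).
Hypotheses (ssmooth : smooth_fun s) (tsmooth : smooth_fun t).
Hypothesis tfhs : forall x, D x -> t (f x) = h (s x).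
Variables (x : M) (Dx : D x).

Local Notation hmx := (passmx.mxof (vbasis {:E}) (vbasis {:E'}) h).

Lemma vcoords_mxof e : vcoords e *m hmx = vcoords (h e).
Proof. by rewrite passmx.mul_mxof [passmx.vecof _ _]vcoordsK. Qed.

(** Translates membership in the image of [h] into the row space condition of [local_lift], with the
    matrix of [h] as [W]. *)
Lemma vcoords_sub_limg e : (vcoords e <= hmx)%MS = (e \in limg h).
Proof.
apply/submxP/memv_imgP => [[y ey]|[e' _ ->]].
  exists (of_vcoords y); rewrite ?memvf//.
  by apply: (can_inj (@vcoordsK _ _)); rewrite ey -vcoords_mxof of_vcoordsK.
by exists (vcoords e'); rewrite vcoords_mxof.
Qed.

Lemma local_compatible z : map_in_charts_dom D f x z ->
  fun_in_chart t (f x) (map_in_charts f x z) = fun_in_chart s x z *m hmx.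
Proof.
case=> y [[cy Dy] cfy] <-.
by rewrite /fun_in_chart /map_in_charts /= !cmapK// vcoords_mxof tfhs.
Qed.

(** Differentiates [t (f x) = h (s x)] in coordinates. The chart chosen at [f x] serves both as
    target chart in [tmap] and as source chart in [tfun], so the two differentials compose. *)
Lemma tfun_tmap v : tfun t (f x) (tmap f x v) = h (tfun s x v).
Proof.
rewrite tfunE tmapE tfunE.
have df : differentiable (map_in_charts f x) (coord x).
  apply: (smooth_on_differentiable (map_in_charts_smooth x fsmooth)).
  exact: nbhs_singleton (map_in_charts_dom_nbhs Dopen fsmooth Dx).
have ds : differentiable (fun_in_chart s x) (coord x).
  apply: (smooth_on_differentiable (fun_in_chart_smooth x ssmooth)).
  exact: nbhs_singleton (fun_in_chart_nbhs _).
have dt : differentiable (fun_in_chart t (f x)) (map_in_charts f x (coord x)).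
  rewrite map_in_charts_coord.
  apply: (smooth_on_differentiable (fun_in_chart_smooth (f x) tsmooth)).
  exact: nbhs_singleton (fun_in_chart_nbhs _).
have := diff_comp_mulmx v df dt ds
  (filterS local_compatible (map_in_charts_dom_nbhs Dopen fsmooth Dx)).
rewrite map_in_charts_coord => ->.
by rewrite /= passmx.mul_mxof [passmx.rVof _ _]/(vcoords _) vcoordsK.
Qed.

(** [local_lift] for the coordinate expressions of [f] and [t], carried back to the manifold. Taking
    [map_in_charts_dom] as the neighbourhood ensures that lifted points come from [D]. *)
Lemma image_nbhs_preim_limg :
  injective (tmap f x) ->
  (tfun t (f x) @^-1: limg h <= limg (tmap f x))%VS ->
  \forall w \near f x, t w \in limg h -> (f @` D) w.
Proof.
move=> finj preim_sub.
have fdom := map_in_charts_dom_nbhs Dopen fsmooth Dx.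
have lift : \forall w \near map_in_charts f x (coord x),
    (fun_in_chart t (f x) w <= hmx)%MS ->
    exists2 z, map_in_charts_dom D f x z & map_in_charts f x z = w.
  apply: (local_lift (A := lin1_mx ('d (map_in_charts f x) (coord x)))
    (B := lin1_mx ('d (fun_in_chart t (f x)) (coord (f x))))) => //.
  - exact: smooth_on_strict_diff (map_in_charts_smooth x fsmooth) fdom.
  - rewrite map_in_charts_coord.
    exact: smooth_on_strict_diff (fun_in_chart_smooth _ tsmooth) (fun_in_chart_nbhs _).
  - by apply: lin1_mx_free => v w; rewrite -!tmapE => /finj.
  - move=> z; rewrite mul_rV_lin1 -[X in (X <= _)%MS]of_vcoordsK -tfunE.
    rewrite vcoords_sub_limg memv_preim => /(subvP preim_sub)/memv_imgP[v _ ->].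
    by rewrite tmapE -mul_rV_lin1 submxMl.
  - by apply: filterS fdom => z /local_compatible ->; exact: submxMl.
move: lift; rewrite map_in_charts_coord => lift.
have cfx := chart_at_dom (f x).
have fx_dom : \forall w \near f x, cdom (chart_at (f x)) w.
  by apply: open_nbhs_nbhs; split => //; exact: cdom_open.
apply: (@filterS2 _ (nbhs (f x)) _ _ _ _ _ (cmap_continuous cfx lift) fx_dom).
move=> w /= wlift cw tw.
have [|_ [y [[cy Dy] cfy] <-]] := wlift.
  by rewrite /fun_in_chart /= cmapK// vcoords_sub_limg.
(* The points [f y] and [w] have equal coordinates and both lie in the domain of the chart, where it
   is injective. *)
rewrite /map_in_charts /= cmapK// => fyw; exists y => //.
by rewrite -(cmapK cfy) fyw cmapK.
Qed.

End Compatible.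

End LocalExpressions.

(** * Coordinate changes *)

Section CoordinateChange.
Variables (R : realType) (X : topologicalType) (KI KJ : kuranishi_chart R X).
Variables (UIJ : set (kU KI)) (phi : kU KI -> kU KJ) (phihat : 'Hom(kE KI, kE KJ)).
Hypothesis hIJ : pre_coordinate_change UIJ phi phihat.

(** The dimension count takes place at a point of [UIJ]. A common point of the footprints comes from
    a zero of the section of [KI], which the footprint condition puts in [UIJ]. *)
Lemma coordinate_domain_neq0 : UIJ !=set0.
Proof.
have [x [FIx FJx]] := pcc_overlap hIJ.
have [psiF _ _ _] := kpsi_homeo KI.
have [u u0 ux] : (kpsi KI @` [set u | ks KI u = 0]) x by rewrite psiF.
have [] : (UIJ `&` Defs.kzero KI) u; last by exists u.
by rewrite (pcc_footprint hIJ); split => //=; rewrite ux.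
Qed.

Lemma section_differentials u : UIJ u -> forall v,
  tfun (ks KJ) (phi u) (tmap phi u v) = phihat (tfun (ks KI) u v).
Proof.
have [phi_smooth _ _] := pcc_embedding hIJ.
move=> Uu v; exact: (tfun_tmap (pcc_open hIJ) phi_smooth (@ks_smooth _ _ KI)
  (@ks_smooth _ _ KJ) (pcc_section hIJ) Uu v).
Qed.

Lemma tmap_injective u : UIJ u -> injective (tmap phi u).
Proof. by have [_ + _] := pcc_embedding hIJ; apply. Qed.

Lemma index_iff_tangent_bundle :
  index_condition UIJ phi phihat <-> tangent_bundle_condition UIJ phi phihat.
Proof.
by split=> cond u Uu; have := index_iff_quotient_iso (section_differentials Uu)
  (pcc_injective hIJ); case=> idx tbc; [apply: idx | apply: tbc]; exact: cond.
Qed.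

Lemma kdim_eqP : kdim KI = kdim KJ <->
  (mdim (kU KI) + \dim {:kE KJ} = mdim (kU KJ) + \dim {:kE KI})%N.
Proof. by rewrite /kdim; split; lia. Qed.

Lemma dim_tangent (M : manifold R) (x : M) : \dim {:tangent x} = mdim M.
Proof. by rewrite dimvf /dim /= mul1n. Qed.

Lemma tangent_bundle_transversality :
  tangent_bundle_condition UIJ phi phihat ->
  transversality_condition UIJ phi phihat.
Proof.
move=> tbc u Uu.
exact: quotient_iso_transversal (section_differentials Uu) (tbc u Uu).
Qed.

Lemma transversality_tangent_bundle : kdim KI = kdim KJ ->
  transversality_condition UIJ phi phihat ->
  tangent_bundle_condition UIJ phi phihat.
Proof.
move=> /kdim_eqP dimE tr u Uu.
apply: (transversal_quotient_iso (section_differentials Uu) (pcc_injective hIJ)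
  (tmap_injective Uu)); last by have [] := tr u Uu.
by rewrite !dim_tangent.
Qed.

Lemma tangent_bundle_kdim :
  tangent_bundle_condition UIJ phi phihat -> kdim KI = kdim KJ.
Proof.
have [u Uu] := coordinate_domain_neq0.
move=> /(_ u Uu)/(quotient_iso_dim (pcc_injective hIJ) (tmap_injective Uu)).
by rewrite !dim_tangent => /kdim_eqP.
Qed.

Lemma tangent_bundle_preim u :
  tangent_bundle_condition UIJ phi phihat -> UIJ u ->
  limg (tmap phi u) = (tfun (ks KJ) (phi u) @^-1: limg phihat)%VS.
Proof. by move=> tbc /tbc/induces_quotient_isoP[-> _]. Qed.

Lemma tangent_bundle_open_image :
  tangent_bundle_condition UIJ phi phihat ->
  open_subset_of (phi @` UIJ) [set w | ks KJ w \in limg phihat].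
Proof.
move=> tbc; have [phi_smooth _ _] := pcc_embedding hIJ.
(* On the set where this implication holds, the preimage of [limg phihat] lies in the image of
   [phi]. The local lift shows that each [phi u] is an interior point of it. *)
exists [set w | ks KJ w \in limg phihat -> (phi @` UIJ) w]^°.
  exact: open_interior.
apply/seteqP; split=> [_ [u Uu <-]|w [/interior_subset + /=]]; last exact.
split; last by rewrite /= (pcc_section hIJ Uu) memv_img ?memvf.
apply: (image_nbhs_preim_limg (pcc_open hIJ) phi_smooth (@ks_smooth _ _ KJ)
  (pcc_section hIJ) Uu (tmap_injective Uu)).
by rewrite -tangent_bundle_preim.
Qed.

End CoordinateChange.

Theorem lemma5p2p5 (R : realType) (X : topologicalType)
    (X_compact : compact [set: X]) (X_metrizable : metrizable R X)
    (KI KJ : kuranishi_chart R X)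
    (UIJ : set (kU KI)) (phi : kU KI -> kU KJ) (phihat : 'Hom(kE KI, kE KJ))
    (hIJ : pre_coordinate_change UIJ phi phihat) :
  (index_condition UIJ phi phihat <-> tangent_bundle_condition UIJ phi phihat)
  /\
  ((tangent_bundle_condition UIJ phi phihat ->
      transversality_condition UIJ phi phihat) /\
   (kdim KI = kdim KJ ->
      (tangent_bundle_condition UIJ phi phihat <->
       transversality_condition UIJ phi phihat)))
  /\
  (tangent_bundle_condition UIJ phi phihat ->
    [/\ kdim KI = kdim KJ,
        open_subset_of (phi @` UIJ)
          [set w | ks KJ w \in limg phihat] &
        forall u, UIJ u ->
          limg (tmap phi u) =
          (tfun (ks KJ) (phi u) @^-1: limg phihat)%VS]).

Proof.
split; first exact: index_iff_tangent_bundle.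
split; first split; first exact: tangent_bundle_transversality.
  move=> dimE; split; first exact: tangent_bundle_transversality.
  exact: transversality_tangent_bundle.
move=> tbc; split; first exact: tangent_bundle_kdim tbc.
  exact: tangent_bundle_open_image.
by move=> u; exact: tangent_bundle_preim.
Qed.
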